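(* $\sup_G \mathrm{mao}(G)/\Lambda(G)=\infty$, where $G$ ranges over all finite groups.
   Context: For a finite group $G$, $\mathrm{mao}(G)$ denotes the maximum order of an automorphism of $G$ (i.e. the maximum element order of $\mathrm{Aut}(G)$), and $\Lambda(G):=\max_{\alpha\in\mathrm{Aut}(G)}\Lambda(\alpha)$, where $\Lambda(\alpha)$ is the largest cycle length of $\alpha$ viewed as a permutation of the underlying set of $G$. *)

(* Defs.v *)
From mathcomp Require Import all_boot all_order all_algebra all_fingroup.

Set Implicit Arguments.
Unset Strict Implicit.
Unset Printing Implicit Defensive.

Local Open Scope group_scope.

Definition mao (gT : finGroupType) (G : {group gT}) : nat :=
  \max_(a in Aut G) #[a].

(* An element of Aut G is a permutation of the ambient type gT fixing every
   point outside G, so its cycles on G are its orbits through points of G. *)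
Definition max_cycle (gT : finGroupType) (G : {group gT}) (a : {perm gT}) : nat :=
  \max_(x in G) #|porbit a x|.

Definition Lambda (gT : finGroupType) (G : {group gT}) : nat :=
  \max_(a in Aut G) max_cycle G a.

(* Main.v *)
Require Import Defs.
From HB Require Import structures.
From mathcomp Require Import all_boot all_order all_algebra all_fingroup.
From mathcomp Require Import cyclic.
From mathcomp Require Import classical_sets reals ereal.

Set Implicit Arguments.
Unset Strict Implicit.
Unset Printing Implicit Defensive.

Import Order.TTheory GRing.Theory Num.Theory.

Local Open Scope ring_scope.

(* Let n = ABC with A, B, C odd and pairwise coprime, each a product of many
   distinct primes, and let G be the semidirect product of Z/n by the Klein
   four-group {1, u, v, uv} of units, where u, v, uv are 1 modulo A, B, C
   respectively and -1 modulo the other two factors.  The centre of G meets Z/n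
   trivially, so conjugation by a generator of Z/n has order n.  On the other
   hand an automorphism preserves each coset of Z/n and acts on it by an affine
   map b |-> a b + c.  On the coset of h, where h = 1 modulo, say, A, the
   relation h^2 = 1 forces c = 0 modulo A, so the cycles there have length at
   most the exponent of (Z/A)^* times BC.  Since p - 1 is even for each of the t
   primes p dividing A, that exponent is at most A / 2^(t-1). *)

(** * The affine group of a finite commutative ring *)

Definition affine (R : finComUnitRingType) : Type := (R * {unit R})%type.

Section AffineGroup.

Variable R : finComUnitRingType.

HB.instance Definition _ := Finite.copy (affine R) (R * {unit R})%type.

Definition affine_one : affine R := (0, 1%g).

(** The pair (b, a) is the map x |-> a x + b; the product is composition, right factor first. *)
Definition affine_mul (g k : affine R) : affine R :=
  (g.1 + val g.2 * k.1, (g.2 * k.2)%g).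

Definition affine_inv (g : affine R) : affine R :=
  (- (val g.2^-1%g * g.1), g.2^-1%g).

Lemma affine_mulA : associative affine_mul.
Proof.
move=> [x a] [y b] [z c].
by rewrite /affine_mul /= mulgA mulrDr mulrA addrA.
Qed.

Lemma affine_mul1 : left_id affine_one affine_mul.
Proof.
by move=> [x a]; rewrite /affine_mul /= mul1r mul1g add0r.
Qed.

Lemma affine_mulV : left_inverse affine_one affine_inv affine_mul.
Proof. by move=> [x a]; rewrite /affine_mul /= addNr mulVg. Qed.

HB.instance Definition _ :=
  Finite_isGroup.Build (affine R) affine_mulA affine_mul1 affine_mulV.

Lemma affineM (g k : affine R) :
  (g * k)%g = (g.1 + val g.2 * k.1, (g.2 * k.2)%g).
Proof. by []. Qed.

Lemma affine1 : 1%g = (0, 1%g) :> affine R.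
Proof. by []. Qed.

Lemma affine_translationX (x : R) (k : nat) :
  (((x, 1%g) : affine R) ^+ k)%g = (x *+ k, 1%g).
Proof.
elim: k => [|k IHk]; first by rewrite expg0 mulr0n.
by rewrite expgS IHk affineM /= mul1r mulg1 mulrS.
Qed.

Lemma affine_snd_expg (g : affine R) (k : nat) : (g ^+ k)%g.2 = (g.2 ^+ k)%g.
Proof. by elim: k => // k IHk; rewrite !expgS affineM /= IHk. Qed.

Variable H : {group {unit R}}.

(** The semidirect product of the additive group of [R] by [H]. *)
Definition affine_over : {set affine R} := [set g | g.2 \in H].

Lemma affine_over_group_set : group_set affine_over.
Proof.
apply/group_setP; split=> [|g k]; first by rewrite inE group1.
by rewrite !inE; apply: groupM.
Qed.

Canonical affine_over_group := Group affine_over_group_set.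

End AffineGroup.

(** * Coprime factors of n and periods of affine recurrences *)

Lemma Zp_nat_eq0 (n k : nat) : (1 < n)%N -> ((k%:R : 'Z_n) == 0) = (n %| k)%N.
Proof. by move=> n_gt1; rewrite -val_eqE /= val_Zp_nat. Qed.

Lemma Zp_coprime_mul_eq0 (n A d : nat) (z : 'Z_n) :
    (1 < n)%N -> n = (A * d)%N -> coprime A d ->
  A%:R * z = 0 -> d%:R * z = 0 -> z = 0.
Proof.
move=> n_gt1 defn coAd; subst n.
rewrite -[z]natr_Zp -!natrM => /eqP Az /eqP dz; apply/eqP.
move: Az dz; rewrite !Zp_nat_eq0 //.
have /andP[A_gt0 d_gt0] : (0 < A)%N && (0 < d)%N by rewrite -muln_gt0 ltnW.
move: (nat_of_ord z) => k; rewrite dvdn_pmul2l // => d_dvd.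
by rewrite mulnC dvdn_pmul2l // Gauss_dvd 1?coprime_sym // d_dvd.
Qed.

(* With n = A d, the equation d x = d y in Z/n encodes x = y modulo A; here the
   hypotheses say that a^e = 1 and c = 0 modulo A. *)
Lemma affine_period (n A d e : nat) (a c : 'Z_n) (y : nat -> 'Z_n) :
    (1 < n)%N -> n = (A * d)%N -> coprime A d ->
    (0 < e)%N -> a \is a GRing.unit ->
    d%:R * a ^+ e = d%:R -> d%:R * c = 0 ->
    (forall i, y i.+1 = a * y i + c) ->
  exists L, [/\ (0 < L)%N, (L <= d * e)%N & y L = y 0].
Proof.
move=> n_gt1 defn coAd e_gt0 ua dae dc yS.
have d_gt0 : (0 < d)%N by move: n_gt1; rewrite defn; case: (d); rewrite ?muln0.
(* Multiplying by A retains exactly the residue modulo d. *)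
have AyE z : A%:R * z = (A * (val z %% d))%:R :> 'Z_n.
  rewrite -[in LHS](natr_Zp z) -natrM [in LHS](divn_eq (val z) d) mulnDr natrD.
  by rewrite mulnCA -defn natrM pchar_Zp // mulr0 add0r.
(* Pigeonhole: among the d + 1 terms y 0, ..., y d two agree modulo d, and since a is a unit the
   coincidence can be shifted back to index 0. *)
have [k [k_gt0 le_kd Ak]] : exists k,
    [/\ (0 < k)%N, (k <= d)%N & A%:R * y k = A%:R * y 0].
  pose f (i : 'I_d.+1) : 'I_d := Ordinal (ltn_pmod (val (y i)) d_gt0).
  have /injectivePn[i [j neq_ij /(congr1 val)/= eqf]] : ~~ injectiveb f.
    by apply/negP=> /injectiveP/leq_card; rewrite !card_ord ltnn.
  have shift m l : A%:R * y (l + m)%N = A%:R * y l -> A%:R * y m = A%:R * y 0.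
    elim: l => // l IHl; rewrite addSn !yS => E; apply: IHl.
    apply: (mulrI ua); rewrite !(mulrCA a).
    by move: E; rewrite !mulrDr => /addIr.
  have eqA : A%:R * y i = A%:R * y j by rewrite !AyE eqf.
  wlog lt_ij : i j neq_ij eqf eqA / (i < j)%N.
    move=> W; case: (ltngtP i j) => [lt_ij|lt_ji|/val_inj eq_ij].
    - exact: (W i j).
    - by apply: (W j i) => //; rewrite eq_sym.
    - by rewrite eq_ij eqxx in neq_ij.
  exists (j - i)%N; split; first by rewrite subn_gt0.
    by rewrite (leq_trans (leq_subr _ _)) // -ltnS ltn_ord.
  by apply: (shift _ i); rewrite subnKC // ltnW.
(* The sequence has period k modulo d and, being y l = a^l y 0 modulo A, period e modulo A. *)
exists (k * e)%N; split; first by rewrite muln_gt0 k_gt0.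
  by rewrite leq_mul2r le_kd orbT.
have AyD l : A%:R * y (l + k)%N = A%:R * y l.
  elim: l => // l IHl.
  by rewrite addSn !yS !mulrDr !(mulrCA A%:R) IHl.
have Ayk l : A%:R * y (l * k)%N = A%:R * y 0.
  by elim: l => // l IHl; rewrite mulSn addnC AyD.
have dy l : d%:R * y l = d%:R * a ^+ l * y 0.
  elim: l => [|l IHl]; first by rewrite expr0 mulr1.
  by rewrite yS mulrDr dc addr0 mulrCA IHl exprS !mulrA (mulrC a).
have dal l : d%:R * a ^+ (l * e)%N = d%:R.
  by elim: l => [|l IHl]; rewrite ?mulr1 // mulSn exprD mulrA dae.
apply/eqP; rewrite -subr_eq0; apply/eqP.
apply: (Zp_coprime_mul_eq0 n_gt1 defn coAd); rewrite mulrBr.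
  by rewrite [(k * e)%N]mulnC Ayk subrr.
by rewrite dy dal subrr.
Qed.

Lemma card_porbit_leq (T : finType) (s : {perm T}) (x : T) (L : nat) :
  (0 < L)%N -> (s ^+ L)%g x = x -> (#|porbit s x| <= L)%N.
Proof.
move=> L_gt0 sLx; rewrite leqNgt; apply/negP=> ltL.
have := uniq_traject_porbit s x => /(nth_uniq x) => /(_ 0 L).
rewrite size_traject ltL (ltn_trans L_gt0 ltL) !nth_traject //; last first.
  exact: ltn_trans ltL.
by rewrite -!permX perm1 sLx eqxx (ltn_eqF L_gt0) => /(_ isT isT).
Qed.

(** * Automorphisms of Z/n extended by a group of involutive units *)

Section AffineAutomorphisms.

Variables (n : nat) (H : {group {unit 'Z_n}}).
Hypotheses (n_gt1 : (1 < n)%N) (n_odd : odd n).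
Hypothesis H_invol : forall h, h \in H -> (h * h = 1)%g.

Let G := affine_over_group H.
Let translation (b : 'Z_n) : affine 'Z_n := (b, 1%g).

Let translation_in b : translation b \in G.
Proof. by rewrite inE group1. Qed.

Let translationX (b : 'Z_n) k : (translation b ^+ k)%g = translation (b *+ k).
Proof. exact: affine_translationX. Qed.

Let H_odd_expg h k : h \in H -> odd k -> (h ^+ k)%g = h.
Proof.
move=> Hh k_odd; rewrite -[k]odd_double_half k_odd -mul2n expgD expgM.
by rewrite (expgS h 1) H_invol // expg1n mulg1.
Qed.

(** The image of a translation has n-th power 1, and h^n = h on [H] because n is odd, so its linear
    part is 1. As 1 generates Z/n, its image determines all the others. *)
Lemma Aut_affine_translation (s : {perm affine 'Z_n}) (b : 'Z_n) :
  s \in Aut G -> s (b, 1%g) = ((s (1, 1%g)).1 * b, 1%g).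
Proof.
move=> sG.
have sX c k : s (translation c ^+ k)%g = (s (translation c) ^+ k)%g.
  exact: (morphX (autm_morphism sG) k (translation_in c)).
have snd1 c : (s (translation c)).2 = 1%g.
  have: (s (translation c) ^+ n = 1)%g.
    rewrite -sX translationX -mulr_natr pchar_Zp //.
    by rewrite mulr0; apply: (morph1 (autm_morphism sG)).
  move/(congr1 snd); rewrite affine_snd_expg.
  have Hs : (s (translation c)).2 \in H.
    by have := Aut_closed sG (translation_in c); rewrite inE.
  by rewrite H_odd_expg.
rewrite -[X in s (X, _)]natr_Zp -[(_, _)]translationX.
rewrite sX [s (translation 1)]surjective_pairing snd1.
by rewrite affine_translationX -mulr_natr natr_Zp.
Qed.

Lemma Aut_affine_coset (s : {perm affine 'Z_n}) (h : {unit 'Z_n}) :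
    s \in Aut G -> h \in H ->
  exists a c : 'Z_n, [/\ a \is a GRing.unit, (1 + val h) * c = 0 &
    forall b, s (b, h) = (a * b + c, h)].
Proof.
move=> sG Hh; pose a := (s (1, 1%g)).1; exists a, (s (0, h)).1.
have sT b := Aut_affine_translation b sG; rewrite -/a in sT.
(* The inverse automorphism also scales translations, and its factor inverts a. *)
have ua : a \is a GRing.unit.
  have := Aut_affine_translation a (groupVr sG).
  have <- : s (1, 1%g) = (a, 1%g) by rewrite sT mulr1.
  rewrite permK => /(congr1 fst) /= E; apply/unitrP.
  by exists ((s^-1)%g (1, 1%g)).1; split; rewrite -?E // mulrC -E.
pose r : affine 'Z_n := (0, h); have Gr : r \in G by rewrite inE.
have sM := morphicP (Aut_morphic sG).
(* Applying s to the relation r t = t^h r, with t translation by 1, gives h' a = a h for the linear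
   part h' of s r; cancel a. *)
have eqh : (s (0, h)).2 = h.
  have : s (r * translation 1%R)%g = s (translation (val h) * r)%g.
    by congr (s _); rewrite !affineM /= mulr0 add0r mulr1 addr0 mulg1 mul1g.
  rewrite !sM ?translation_in // !sT !affineM => /(congr1 fst) /=.
  by rewrite mulr1 mul1r addrC => /addIr; rewrite mulrC => /(mulrI ua) /val_inj.
split=> // [|b].
  (* The involution r must go to an involution or 1, which constrains c. *)
  have : s (r * r)%g = 1%g.
    rewrite affineM /= mulr0 add0r H_invol // -affine1.
    exact: (morph1 (autm_morphism sG)).
  rewrite sM // affineM eqh => /(congr1 fst) /=.
  by rewrite mulrDl mul1r.
have -> : (b, h) = (translation b * r)%g.
  by rewrite affineM /= mulr0 addr0 mul1g.
by rewrite sM ?translation_in // sT affineM eqh /= mul1r mul1g.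
Qed.

(** If conjugation by translation by 1 has order k, then translation by k is central; commuting with
    each (0, h) makes k a fixed point of [H], hence 0 in Z/n. *)
Lemma leq_mao_affine :
    (forall b : 'Z_n, (forall h, h \in H -> val h * b = b) -> b = 0) ->
  (n <= mao G)%N.
Proof.
move=> fix0; pose t := translation 1.
have Ct : conj_aut G t \in Aut G := Aut_aut _ _.
suff n_dvd : (n %| #[conj_aut G t]%g)%N.
  apply: leq_trans (dvdn_leq (order_gt0 _) n_dvd) _.
  by rewrite /mao (bigD1 (conj_aut G t)) //= leq_maxl.
set k := #[_]%g; rewrite -Zp_nat_eq0 //; apply/eqP/fix0 => h Hh.
have NGt : (t \in 'N(G))%g.
  by rewrite (fintype.subsetP (normG _)) ?translation_in.
have : (t ^+ k \in 'C(G))%g.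
  rewrite -ker_conj_aut; apply/kerP; first exact: groupX.
  by rewrite (morphX (conj_aut_morphism G)) //= expg_order.
rewrite translationX => /centP/(_ (0, h)).
rewrite inE => /(_ Hh); rewrite /commute !affineM => /(congr1 fst) /=.
by rewrite mulr0 addr0 add0r.
Qed.

Lemma card_porbit_affine (s : {perm affine 'Z_n}) (b : 'Z_n) (h : {unit 'Z_n})
    (A d e : nat) :
    n = (A * d)%N -> coprime A d -> (0 < e)%N ->
    d%:R * val h = d%:R ->
    (forall a : 'Z_n, a \is a GRing.unit -> d%:R * a ^+ e = d%:R) ->
    s \in Aut G -> h \in H ->
  (#|porbit s (b, h)| <= d * e)%N.
Proof.
move=> defn coAd e_gt0 dh de sG Hh.
have [a [c [ua hc sE]]] := Aut_affine_coset sG Hh.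
(* Modulo A, h = 1 turns (1 + h) c = 0 into 2 c = 0, and 2 is invertible as n is odd. *)
have dc : d%:R * c = 0.
  have u2 : (2%:R : 'Z_n) \is a GRing.unit by rewrite unitZpE // coprimen2.
  have d2 : d%:R * 2%:R = d%:R * (1 + val h).
    by rewrite [in RHS]mulrDr dh mulr1 mulr_natr mulr2n.
  by apply: (mulIr u2); rewrite mul0r mulrAC d2 -mulrA hc mulr0.
pose y i := ((s ^+ i)%g (b, h)).1.
have sy i : (s ^+ i)%g (b, h) = (y i, h).
  rewrite [LHS]surjective_pairing; congr (_, _).
  elim: i => [|i IHi]; first by rewrite expg0 perm1.
  by rewrite expgSr permM [X in s X]surjective_pairing IHi sE.
have yS i : y i.+1 = a * y i + c by rewrite {1}/y expgSr permM sy sE.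
have [L [L_gt0 leL yL]] :=
  affine_period n_gt1 defn coAd e_gt0 ua (de a ua) dc yS.
apply: leq_trans leL; apply: card_porbit_leq => //.
by rewrite sy yL /y expg0 perm1.
Qed.

End AffineAutomorphisms.

(** * Odd moduli whose unit groups have small exponent *)

(** Primes are adjoined one at a time: e and p - 1 are both even, so e (p - 1)/2 is a multiple of
    both, and each new prime gains a factor 2. Evenness of e is kept for the induction. *)
Lemma exists_small_exponent (D t : nat) : (0 < D)%N ->
  exists A e, [/\ [/\ odd A, (1 < A)%N & coprime A D],
    [/\ (0 < e)%N, ~~ odd e & (e * 2 ^ t <= A)%N]
    & forall a, coprime a A -> a ^ e = 1 %[mod A]].
Proof.
have large_prime m : (0 < m)%N ->
    exists p, [/\ prime p, odd p, (1 < p)%N & coprime p m].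
  (* A prime above 2 m exceeds 2, so it is odd, and exceeds m, so it does not divide m. *)
  move=> m_gt0; have [p lt_p p_pr] := prime_above m.*2.
  have p_gt2 : (2 < p)%N.
    by apply: leq_ltn_trans lt_p; rewrite (leq_double 1).
  exists p; split; rewrite ?prime_gt1 //.
    by case: (even_prime p_pr) p_gt2 => [->|].
  rewrite prime_coprime //; apply/negP=> /dvdn_leq; rewrite m_gt0 => /(_ isT).
  by rewrite leqNgt (leq_ltn_trans _ lt_p) // -addnn leq_addr.
move=> D_gt0.
elim: t => [|t [A [e [[A_odd A_gt1 coAD] [e_gt0 e_even le_e] expA]]]].
  have [p [p_pr p_odd p_gt1 coDp]] := large_prime D D_gt0.
  exists p, p.-1; split; first by split.
    split; first by rewrite -subn1 subn_gt0.
      by case: (p) p_odd.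
    by rewrite muln1 leq_pred.
  by move=> a co_ap; rewrite -(totient_prime p_pr) Euler_exp_totient.
have DA_gt0 : (0 < D * A)%N by rewrite muln_gt0 D_gt0 ltnW.
have [p [p_pr p_odd p_gt1]] := large_prime _ DA_gt0.
rewrite coprimeMr => /andP[co_pD co_pA].
have pE : p.-1 = (p.-1)./2.*2.
  by rewrite -[LHS]odd_double_half; case: (p) p_odd => //= q /negPf->.
have eE : e = e./2.*2 by rewrite -[LHS]odd_double_half (negPf e_even).
have half_gt0 : (0 < (p.-1)./2)%N by rewrite -double_gt0 -pE -subn1 subn_gt0.
exists (A * p)%N, (e * (p.-1)./2)%N; split.
- rewrite oddM A_odd p_odd coprimeMl coAD co_pD; split=> //.
  by rewrite (leq_trans p_gt1) // leq_pmull // ltnW.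
- split; first by rewrite muln_gt0 e_gt0.
    by rewrite oddM (negPf e_even).
  rewrite expnSr mulnACA muln2 -pE leq_mul ?leq_pred //.
- move=> a; rewrite coprimeMr => /andP[co_aA co_ap].
  apply/eqP; rewrite chinese_remainder 1?coprime_sym //.
  apply/andP; split; apply/eqP.
    by rewrite expnM -modnXm expA // modnXm exp1n.
  have -> : (e * (p.-1)./2 = p.-1 * e./2)%N.
    rewrite [X in (X * _ = _)%N]eE [X in (_ = X * _)%N]pE -!muln2.
    by rewrite mulnC -mulnA (mulnC 2).
  rewrite expnM -(totient_prime p_pr) -modnXm Euler_exp_totient //.
  by rewrite modnXm exp1n.
Qed.

(** * Units of Z/n: exponents, signs and the Klein four-group *)

Lemma Zp_unit_exponent (n A d e : nat) (a : 'Z_n) :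
    (1 < n)%N -> n = (A * d)%N -> (1 < A)%N ->
    (forall a, coprime a A -> a ^ e = 1 %[mod A]) ->
    a \is a GRing.unit ->
  d%:R * a ^+ e = d%:R.
Proof.
move=> n_gt1 defn A_gt1 expA; rewrite -[a]natr_Zp; move: (nat_of_ord a) => k.
rewrite unitZpE // coprime_sym {1}defn coprimeMr => /andP[/expA eqk _].
rewrite -natrX -natrM (divn_eq (k ^ e) A) eqk modn_small // mulnDr muln1.
by rewrite natrD mulnCA [(d * A)%N]mulnC -defn natrM pchar_Zp // mulr0 add0r.
Qed.

Lemma Zp_sign (n A d : nat) :
    (1 < n)%N -> n = (A * d)%N -> coprime A d ->
  exists u : {unit 'Z_n}, [/\ (u * u = 1)%g,
    d%:R * val u = d%:R & A%:R * val u = - A%:R].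
Proof.
move=> n_gt1 defn coAd.
have A_gt0 : (0 < A)%N by move: n_gt1; rewrite defn; case: (A).
have Ad0 : A%:R * d%:R = 0 :> 'Z_n by rewrite -natrM -defn pchar_Zp.
case: (egcdnP d A_gt0) => k l; rewrite (eqP coAd) => kl _.
have {}kl : A%:R * k%:R = d%:R * l%:R + 1 :> 'Z_n.
  by rewrite -natrM mulnC kl natrD natrM mulrC.
(* By Bezout, A k is 0 modulo A and 1 modulo d, so u is 1 modulo A and -1 modulo d. *)
pose u : 'Z_n := 1 - 2%:R * (A%:R * k%:R).
have du : d%:R * u = d%:R.
  rewrite /u mulrBr mulr1 mulrCA (mulrA d%:R) (mulrC d%:R A%:R) Ad0.
  by rewrite mul0r mulr0 subr0.
have Au : A%:R * u = - A%:R.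
  rewrite /u kl mulrBr mulr1 mulrCA mulrDr (mulrA A%:R) Ad0 mul0r add0r mulr1.
  by rewrite mulr_natl mulr2n opprD addrA subrr add0r.
have uu : u * u = 1.
  apply/eqP; rewrite -subr_eq0; apply/eqP.
  apply: (Zp_coprime_mul_eq0 n_gt1 defn coAd); rewrite mulrBr mulrA mulr1.
    by rewrite Au mulNr Au opprK subrr.
  by rewrite du du subrr.
have Uu : u \is a GRing.unit by apply/unitrP; exists u.
by exists (FinRing.unit 'Z_n Uu); split=> //; apply: val_inj.
Qed.

Lemma klein_four_group_set (gT : finGroupType) (u v : gT) :
    (u * u = 1)%g -> (v * v = 1)%g -> (v * u = u * v)%g ->
  group_set [set 1%g; u; v; (u * v)%g].
Proof.
move=> uu vv vu; apply/group_setP; split=> [|x y]; first by rewrite !inE eqxx.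
have uuv : (u * (u * v) = v)%g by rewrite mulgA uu mul1g.
have vuv : (v * (u * v) = u)%g by rewrite -vu mulgA vv mul1g.
have uvu : (u * v * u = v)%g by rewrite -mulgA vu.
have uvv : (u * v * v = u)%g by rewrite -mulgA vv mulg1.
have uvuv : (u * v * (u * v) = 1)%g by rewrite mulgA uvu.
rewrite !inE -!orbA => /or4P[]/eqP-> /or4P[]/eqP->;
  by rewrite ?mulg1 ?mul1g ?uu ?vv ?vu ?uuv ?vuv ?uvu ?uvv ?uvuv eqxx ?orbT.
Qed.

(** * The groups with large ratio *)

Lemma exists_mao_ge_Lambda (t : nat) :
  exists (gT : finGroupType) (G : {group gT}),
    (0 < Lambda G)%N /\ (Lambda G * 2 ^ t <= mao G)%N.
Proof.
have [A [e [[A_odd A_gt1 _] [e_gt0 _ le_e] expA]]] :=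
  exists_small_exponent t (ltn0Sn 0).
have A_gt0 := ltnW A_gt1.
have [B [f [[B_odd B_gt1 coBA] [f_gt0 _ le_f] expB]]] :=
  exists_small_exponent t A_gt0.
have B_gt0 := ltnW B_gt1.
have AB_gt0 : (0 < A * B)%N by rewrite muln_gt0 A_gt0.
have [C [g [[C_odd C_gt1 coCAB] [g_gt0 _ le_g] expC]]] :=
  exists_small_exponent t AB_gt0.
have C_gt0 := ltnW C_gt1.
pose n := (A * (B * C))%N.
have defB : n = (B * (A * C))%N by rewrite /n mulnCA.
have defC : n = (C * (A * B))%N by rewrite /n mulnA mulnC.
have n_odd : odd n by rewrite !oddM A_odd B_odd.
have n_gt1 : (1 < n)%N
  by rewrite (leq_trans A_gt1) // leq_pmulr // muln_gt0 B_gt0.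
have [coCA coCB] : coprime C A /\ coprime C B.
  by move: coCAB; rewrite coprimeMr => /andP.
have coA : coprime A (B * C).
  by rewrite coprimeMr ![coprime A _]coprime_sym coBA.
have coB : coprime B (A * C) by rewrite coprimeMr coBA coprime_sym.
have [u [uu du Au]] := Zp_sign n_gt1 (erefl n) coA.
have [v [vv dv Bv]] := Zp_sign n_gt1 defB coB.
have vu : (v * u = u * v)%g by apply: unit_Zp_mulgC.
pose H := Group (klein_four_group_set uu vv vu).
have H_invol h : h \in H -> (h * h = 1)%g.
  rewrite !inE -!orbA => /or4P[]/eqP->; rewrite ?mulg1 //.
  by rewrite -mulgA (mulgA v) vu -(mulgA u) vv mulg1.
pose G := affine_over_group H.
exists (affine 'Z_n), G.
have le_n : (n <= mao G)%N.
  apply: leq_mao_affine => // b fixb.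
  have u2 : (2%:R : 'Z_n) \is a GRing.unit by rewrite unitZpE // coprimen2.
  (* If w = -1 modulo n/m, then w b = b gives 2 b = 0 there. Using u and v, b vanishes modulo B C
     and modulo A C, hence modulo n. *)
  have kill (w : {unit 'Z_n}) m :
      w \in H -> m%:R * val w = - m%:R -> m%:R * b = 0.
    move=> Hw mw; apply: (mulIr u2); rewrite mul0r mulr_natr mulr2n.
    by rewrite -[X in _ * X + _](fixb w Hw) mulrA mw mulNr addNr.
  apply: (Zp_coprime_mul_eq0 n_gt1 (erefl n) coA).
    by apply: (kill u); rewrite // !inE eqxx ?orbT.
  rewrite mulnC natrM -mulrA (kill v) ?mulr0 //.
  by rewrite !inE eqxx ?orbT.
(* Each h is 1 modulo one of A, B, C; for u v it is C, where both signs are -1. *)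
have split_h h : h \in H -> exists K d k, [/\ n = (K * d)%N, coprime K d,
    [/\ (1 < K)%N, (0 < k)%N & (k * 2 ^ t <= K)%N], d%:R * val h = d%:R
    & forall a, coprime a K -> a ^ k = 1 %[mod K]].
  rewrite !inE -!orbA => /or4P[]/eqP->.
  - by exists A, (B * C)%N, e; split; rewrite // mulr1.
  - by exists A, (B * C)%N, e; split.
  - by exists B, (A * C)%N, f; split.
  - exists C, (A * B)%N, g; split=> //.
    by rewrite natrM mulrACA Au Bv mulrNN.
have le_porbit s x : s \in Aut G -> x \in G -> (#|porbit s x| <= n %/ 2 ^ t)%N.
  case: x => b h sG; rewrite inE => Hh.
  have [K [d [k [defn coKd [K_gt1 k_gt0 le_k] dh expK]]]] := split_h h Hh.
  have := card_porbit_affine n_gt1 n_odd H_invol b defn coKd k_gt0 dh _ sG Hh.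
  have dk (a : 'Z_n) := Zp_unit_exponent n_gt1 defn K_gt1 expK (a := a).
  move=> /(_ dk) le_dk; apply: leq_trans le_dk _.
  rewrite leq_divRL ?expn_gt0 // -mulnA defn [(K * d)%N]mulnC.
  by rewrite leq_mul2l le_k orbT.
split.
  have G1 : 1%g \in G by apply: group1.
  have A1 : 1%g \in Aut G by apply: group1.
  rewrite /Lambda (bigD1 1%g) //= /max_cycle (bigD1 1%g) //= !leq_max lt0n.
  by rewrite card_porbit_neq0.
apply: leq_trans le_n; rewrite -leq_divRL ?expn_gt0 //.
apply/bigmax_leqP => s sG; apply/bigmax_leqP => x xG; exact: le_porbit.
Qed.

Local Open Scope classical_set_scope.
Local Open Scope ring_scope.

Theorem proposition3p1 (R : realType) :
  ereal_sup [set r : \bar R | exists (gT : finGroupType) (G : {group gT}),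
                r = ((mao G)%:R / (Lambda G)%:R)%:E] = +oo%E.
Proof.
(* It suffices to reach every real M; this t satisfies M < t < 2^t. *)
apply/eqyP => M _; pose t := (Num.truncn M).+1.
have [gT [G [L_gt0 leL]]] := exists_mao_ge_Lambda t.
apply: (@le_trans _ _ ((mao G)%:R / (Lambda G)%:R)%:E); last first.
  by apply: ereal_sup_ubound; exists gT, G.
rewrite lee_fin ler_pdivlMr ?ltr0n //.
apply: le_trans (_ : (2 ^ t)%:R * (Lambda G)%:R <= _); last first.
  by rewrite -natrM ler_nat mulnC.
rewrite ler_wpM2r //; apply/ltW/(lt_le_trans (truncnS_gt M)).
by rewrite ler_nat ltnW // ltn_expl.
Qed.
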